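(* For every integer $n \ge 3$: if $R_3(C_{2n}) = 4n$, then $R_3(P_{2n+1}) = 4n+1$.
   Context: All graphs are undirected, finite, with no loops or multiple edges. $P_k$ (resp. $C_k$) denotes the path (resp. cycle) on $k$ vertices, and $K_N$ denotes the complete graph on $N$ vertices. For a graph $G$, the three-color diagonal Ramsey number $R_3(G) = R(G,G,G)$ is the smallest integer $N$ such that every coloring of the edges of $K_N$ with 3 colors contains a monochromatic copy of $G$ (as a not necessarily induced subgraph), i.e. there is a color $i \in \{1,2,3\}$ such that the graph formed by the edges of color $i$ contains a subgraph isomorphic to $G$. *)

(* Defs.v *)
From mathcomp Require Import all_boot.

Set Implicit Arguments.
Unset Strict Implicit.
Unset Printing Implicit Defensive.

Record sgraph := SGraph {
  vertex :> finType;
  adj : rel vertex;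
  adj_sym : symmetric adj;
  adj_irrefl : irreflexive adj }.

(* H contains a copy of G as a not necessarily induced subgraph. *)
Definition contains (H G : sgraph) : Prop :=
  exists f : G -> H,
    injective f /\ forall x y : G, adj x y -> adj (f x) (f y).

Section Complete.
Variable N : nat.

Definition complete_rel (x y : 'I_N) := x != y.

Lemma complete_rel_sym : symmetric complete_rel.
Proof. by move=> x y; rewrite /complete_rel eq_sym. Qed.

Lemma complete_rel_irrefl : irreflexive complete_rel.
Proof. by move=> x; rewrite /complete_rel eqxx. Qed.

Definition complete_graph := SGraph complete_rel_sym complete_rel_irrefl.

End Complete.

Section Path.
Variable k : nat.

Definition path_rel (x y : 'I_k) := (x.+1 == y :> nat) || (y.+1 == x :> nat).

Lemma path_rel_sym : symmetric path_rel.
Proof. by move=> x y; rewrite /path_rel orbC. Qed.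

Lemma path_rel_irrefl : irreflexive path_rel.
Proof. by move=> x; rewrite /path_rel orbb gtn_eqF. Qed.

(* P_k: the path on k vertices. *)
Definition path_graph := SGraph path_rel_sym path_rel_irrefl.

End Path.

Section Cycle.
Variable k : nat.

(* ordS is the cyclic successor; the conjunct x != y only matters for k = 1,
   where ordS has a fixed point. *)
Definition cycle_rel (x y : 'I_k) :=
  (x != y) && ((ordS x == y) || (ordS y == x)).

Lemma cycle_rel_sym : symmetric cycle_rel.
Proof. by move=> x y; rewrite /cycle_rel eq_sym orbC. Qed.

Lemma cycle_rel_irrefl : irreflexive cycle_rel.
Proof. by move=> x; rewrite /cycle_rel eqxx. Qed.

(* C_k: the cycle on k vertices (meaningful for k >= 3). *)
Definition cycle_graph := SGraph cycle_rel_sym cycle_rel_irrefl.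

End Cycle.

(* The edge {x, y} is coloured by c [set x; y]; the values of c on sets that
   are not edges of H are irrelevant. *)
Definition edge_coloring (H : sgraph) (r : nat) := {set H} -> 'I_r.

Section ColorClass.
Variables (H : sgraph) (r : nat) (c : edge_coloring H r) (i : 'I_r).

Definition color_rel (x y : H) := adj x y && (c [set x; y] == i).

Lemma color_rel_sym : symmetric color_rel.
Proof. by move=> x y; rewrite /color_rel adj_sym setUC. Qed.

Lemma color_rel_irrefl : irreflexive color_rel.
Proof. by move=> x; rewrite /color_rel adj_irrefl. Qed.

Definition color_class := SGraph color_rel_sym color_rel_irrefl.

End ColorClass.

Definition ramsey3_arrows (N : nat) (G : sgraph) : Prop :=
  forall c : edge_coloring (complete_graph N) 3,
    exists i : 'I_3, contains (color_class c i) G.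

(* R_3(G) = N. *)
Definition is_ramsey3 (G : sgraph) (N : nat) : Prop :=
  ramsey3_arrows N G /\ forall M : nat, ramsey3_arrows M G -> M >= N.

(* Main.v *)
Require Import Defs.
From mathcomp Require Import all_boot.
From mathcomp Require Import zify.

(** Upper bound.  Colour the edges of K_{4n+1} and suppose that there is no
    monochromatic P_{2n+1}; then no edge leaving a monochromatic 2n-cycle has
    the colour of that cycle.  If C and C' are 2n-cycles of distinct colours,
    the third colour is therefore complete between C \ C' and C' \ C, and
    between C :&: C' and the complement of their union; one of these two
    bipartite graphs contains P_{2n+1}.  So all monochromatic 2n-cycles are,
    say, red.  Deleting a vertex of a red 2n-cycle A yields a second one, B,
    disjoint from A, and a last vertex d; red edges stay within A or within B.
    Now delete b in B, pick a in A, and recolour the edges at a: towards A use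
    the colours of b, towards B keep those of a, and make ad red.  No red
    2n-cycle survives, so there is a 2n-cycle of another colour.  It enters and
    leaves a towards the same part, and then it is (with b in place of a if need
    be) a cycle of the original colouring, or towards different parts, and then
    splitting a into a and b opens it up into a path on 2n+1 vertices.

    Lower bound.  Split at most 4n vertices into four parts of size at most n,
    indexed by F_2^2, and colour by the three perfect matchings of K_4: every
    monochromatic component has at most 2n vertices. *)

Set Implicit Arguments.
Unset Strict Implicit.
Unset Printing Implicit Defensive.

(** * Edge colourings, paths and cycles as vertex sequences *)

Definition mono_rel (T : Type) (r : nat) (col : T -> T -> 'I_r) (i : 'I_r) : rel T :=
  fun x y => col x y == i.

Lemma mono_rel_sym (T : Type) (r : nat) (col : T -> T -> 'I_r) (i : 'I_r) :
  (forall x y, col x y = col y x) -> symmetric (mono_rel col i).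
Proof. by move=> colC x y; rewrite /mono_rel colC. Qed.

(** A set [[set x; y]] determines its pair only up to order; the pair picked for it may be reversed,
    which symmetry of [col] makes harmless. *)
Lemma edge_coloring_of_fun (H : sgraph) (r : nat) (col : H -> H -> 'I_r.+1) :
  (forall x y, col x y = col y x) ->
  exists c : edge_coloring H r.+1, forall x y, c [set x; y] = col x y.
Proof.
move=> colC.
exists (fun S => if [pick p : H * H | S == [set p.1; p.2]] is Some p
                 then col p.1 p.2 else ord0) => x y.
case: pickP => [[u v] /= /eqP E|/(_ (x, y))]; last by rewrite eqxx.
have /set2P xu : x \in [set u; v] by rewrite -E set21.
have /set2P yu : y \in [set u; v] by rewrite -E set22.
have /set2P ux : u \in [set x; y] by rewrite E set21.
have /set2P vx : v \in [set x; y] by rewrite E set22.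
by have := colC x y; case: xu yu ux vx => [?|?] [?|?] [?|?] [?|?]; congruence.
Qed.

Section SymmetricRelation.
Variables (T : eqType) (e : rel T).
Hypothesis eC : symmetric e.

(** The cycle is cut open at [x] and [y] is put in front of it. *)
Lemma cycle_pendant_path (s : seq T) x y :
  uniq s -> cycle e s -> x \in s -> y \notin s -> e x y ->
  exists t, [/\ uniq t, size t = (size s).+1 & sorted e t].
Proof.
move=> Us Cs xs ys exy; case: (rot_to xs) => k s' E.
exists (y :: x :: s'); split.
- by rewrite cons_uniq -E mem_rot ys rot_uniq.
- by rewrite -E /= size_rot.
- rewrite /= eC exy /=.
  by move: Cs; rewrite -(rot_cycle k) E /= rcons_path => /andP[].
Qed.

Lemma alternating_path (xs ys : seq T) y0 :
  size xs = size ys ->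
  (forall x y, x \in xs -> y \in y0 :: ys -> e x y) ->
  exists2 p, path e y0 p & perm_eq p (xs ++ ys).
Proof.
elim: xs ys y0 => [|x xs IH] [|y ys] y0 //= => [_ _|[sz] exy]; first by exists [::].
have [|p pP pE] := IH ys y sz.
  by move=> u v uxs vys; apply: exy; rewrite in_cons ?uxs ?vys orbT.
exists (x :: y :: p).
  by rewrite /= eC !exy ?pP // ?inE ?eqxx ?orbT.
by rewrite perm_cons -cat1s perm_sym -(cat1s y) perm_catCA /= perm_cons perm_sym.
Qed.

End SymmetricRelation.

(** The path alternates between the sides and has both ends in [Y], hence the strict bound on that
    side only. *)
Lemma complete_bipartite_path (T : finType) (e : rel T) (X Y : {set T}) (m : nat) :
  symmetric e -> [disjoint X & Y] -> m <= #|X| -> m < #|Y| ->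
  (forall x y, x \in X -> y \in Y -> e x y) ->
  exists t, [/\ uniq t, size t = (2 * m).+1 & sorted e t].
Proof.
move=> eC dXY mX mY exy.
set xs := take m (enum X); set ys := take m.+1 (enum Y).
have xsX x : x \in xs -> x \in X by move/mem_take; rewrite mem_enum.
have ysY y : y \in ys -> y \in Y by move/mem_take; rewrite mem_enum.
have sxs : size xs = m by rewrite size_takel // -cardE.
have sys : size ys = m.+1 by rewrite size_takel // -cardE.
have U : uniq (xs ++ ys).
  rewrite cat_uniq !take_uniq ?enum_uniq // andbT.
  apply/hasPn => y /ysY yY; apply: contraL yY => /xsX xX.
  by rewrite (disjointFr dXY).
case: ys sys ysY U => [|y0 ys] //= [sys] ysY U.
have [||p pP pE] := @alternating_path _ _ eC xs ys y0; first by rewrite sxs.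
  by move=> x y /xsX xX /ysY yY; apply: exy.
exists (y0 :: p); split=> //.
- have : perm_eq (y0 :: p) (xs ++ y0 :: ys).
    by rewrite perm_sym -cat1s perm_catCA /= perm_cons perm_sym.
  by move/perm_uniq ->.
- by rewrite /= (perm_size pE) size_cat sxs sys mul2n addnn.
Qed.

Lemma path_const (T : eqType) (L : Type) (e : rel T) (lab : T -> L) x s :
  (forall u v, u \in x :: s -> v \in x :: s -> e u v -> lab u = lab v) ->
  path e x s -> forall y, y \in x :: s -> lab y = lab x.
Proof.
elim: s x => [|z s IH] x labE /=; first by move=> _ y; rewrite inE => /eqP ->.
case/andP=> exz pz y; rewrite inE => /predU1P[-> //|ys].
rewrite (IH z) //; last by move=> u v us vs; apply: labE; rewrite inE ?us ?vs orbT.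
by apply/esym/labE; rewrite // !inE eqxx ?orbT.
Qed.

Lemma cycle_nth (T : Type) (e : rel T) (s : seq T) x0 :
  (forall i, i < size s -> e (nth x0 s i) (nth x0 s (i.+1 %% size s))) -> cycle e s.
Proof.
case: s => //= x p es; apply/(pathP x0) => i; rewrite size_rcons => ip.
have := es i ip; rewrite -rcons_cons !nth_rcons /= ip.
have [lt|ge] := ltnP i (size p); first by rewrite modn_small.
have -> : i = size p by apply/eqP; rewrite eqn_leq ge -ltnS ip.
by rewrite eqxx modnn.
Qed.

Lemma cycle_map_enum_ord (T : Type) (e : rel T) (k : nat) (f : 'I_k -> T) :
  (forall x, e (f x) (f (ordS x))) -> cycle e (map f (enum 'I_k)).
Proof.
case: k f => [|k] f ef; first by rewrite (size0nil (size_enum_ord 0)).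
have fE (x : 'I_k.+1) : nth (f ord0) (map f (enum 'I_k.+1)) x = f x.
  by rewrite (nth_map ord0) ?size_enum_ord // nth_ord_enum.
apply: (@cycle_nth _ _ _ (f ord0)) => m; rewrite size_map size_enum_ord => mk.
by rewrite (fE (Ordinal mk)) (fE (ordS (Ordinal mk))).
Qed.

(** * Upper bound: recolouring at a vertex of a red cycle *)

Section UpperBound.
Variables (V : finType) (n : nat).
Hypothesis n2 : 1 < n.
Hypothesis cardV : #|V| = (4 * n).+1.

(** All colourings are allowed here because the property is applied to [col] and also to a
    recoloured version of it. *)
Hypothesis mono_cycle : forall (col : V -> V -> 'I_3) (b : V),
  (forall x y, col x y = col y x) ->
  exists i s, [/\ uniq s, size s = 2 * n, b \notin s & cycle (mono_rel col i) s].

Variable col : V -> V -> 'I_3.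
Hypothesis colC : forall x y, col x y = col y x.
Hypothesis no_path : ~ exists i t,
  [/\ uniq t, size t = (2 * n).+1 & sorted (mono_rel col i) t].

Lemma cycle_closed i s x y :
  uniq s -> size s = 2 * n -> cycle (mono_rel col i) s ->
  x \in s -> y \notin s -> col x y != i.
Proof.
move=> Us Ss Cs xs ys; apply/negP => cxy; apply: no_path.
have [|t [Ut St Pt]] := cycle_pendant_path (mono_rel_sym i colC) Us Cs xs ys.
  exact: cxy.
by exists i, t; split; rewrite // St Ss.
Qed.

Lemma cycle_mem_eq i s x y :
  uniq s -> size s = 2 * n -> cycle (mono_rel col i) s ->
  col x y = i -> (x \in s) = (y \in s).
Proof.
move=> Us Ss Cs cxy; apply/idP/idP => [xs|ys]; apply: contraT => out.
  by have := cycle_closed Us Ss Cs xs out; rewrite cxy eqxx.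
by have := cycle_closed Us Ss Cs ys out; rewrite colC cxy eqxx.
Qed.

Lemma third_color (i j : 'I_3) : i != j ->
  exists l : 'I_3, forall k, k != i -> k != j -> k = l.
Proof.
move=> ij.
have i3 := ltn_ord i; have j3 := ltn_ord j.
(* The three colours sum to 3, which gives the remaining one. *)
have l3 : 3 - (i + j) < 3 by move: ij; rewrite -val_eqE /=; lia.
exists (Ordinal l3) => k; rewrite -!val_eqE /= => ki kj; apply: val_inj => /=.
by move: ij (ltn_ord k) (ltn_ord j); rewrite -val_eqE /=; lia.
Qed.

Lemma cycle_same_color i j s t :
  uniq s -> size s = 2 * n -> cycle (mono_rel col i) s ->
  uniq t -> size t = 2 * n -> cycle (mono_rel col j) t -> i = j.
Proof.
move=> Us Ss Cs Ut St Ct; apply/eqP/negPn/negP => ij; apply: no_path.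
have [l lP] := third_color ij; exists l.
have lC := mono_rel_sym l colC.
pose S := [set x in s]; pose R := [set x in t].
have cS : #|S| = 2 * n by rewrite cardsE (card_uniqP Us).
have cR : #|R| = 2 * n by rewrite cardsE (card_uniqP Ut).
have cD := cardsID R S; have cD' := cardsID S R; rewrite setIC in cD'.
have cU := cardsUI S R; have cC := cardsC (S :|: R).
rewrite cardV in cC.
(* With [k] common vertices, the complement of the union has [k + 1] vertices and each difference
   has [2 * n - k]. The first bipartite graph is large enough when [n <= k], the second when
   [k < n]. *)
have [big|small] := leqP n #|S :&: R|.
  apply: (@complete_bipartite_path _ _ (S :&: R) (~: (S :|: R))) => //.
  - rewrite disjoints_subset setCK; apply: subset_trans (subsetIl _ _) (subsetUl _ _).
  - lia.
  - move=> x y; rewrite !inE negb_or => /andP[xs xt] /andP[ys yt].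
    by apply/eqP/lP; [apply: cycle_closed Cs xs ys|apply: cycle_closed Ct xt yt].
apply: (@complete_bipartite_path _ _ (S :\: R) (R :\: S)) => //; try lia.
- rewrite disjoints_subset; apply/subsetP => x.
  by rewrite !inE => /andP[/negPf -> ->].
- move=> x y; rewrite !inE => /andP[xt xs] /andP[ys yt].
  apply/eqP/lP; first exact: cycle_closed Cs xs ys.
  by rewrite colC; apply: cycle_closed Ct yt xt.
Qed.

Lemma two_disjoint_cycles : exists red s t,
  [/\ uniq s, size s = 2 * n & cycle (mono_rel col red) s] /\
  [/\ uniq t, size t = 2 * n, cycle (mono_rel col red) t & {in s, forall x, x \notin t}].
Proof.
have /card_gt0P[v0 _] : 0 < #|V| by rewrite cardV.
have [i [s [Us Ss _ Cs]]] := mono_cycle v0 colC.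
have [c cs] : exists c, c \in s.
  by case: (s) Ss => [|c s'] /= Ss; [lia | exists c; rewrite inE eqxx].
have [j [t [Ut St ct Ct]]] := mono_cycle c colC.
have ij := cycle_same_color Us Ss Cs Ut St Ct; subst j.
exists i, s, t; split; split=> //.
move=> x xs; apply/negP => xt.
(* A red cycle meeting s cannot leave s, so it would be all of s. *)
have sub : {subset t <= s}.
  case: (rot_to xt) => k t' E y; rewrite -(mem_rot k) E => yt.
  have Pt : path (mono_rel col i) x t'.
    by move: Ct; rewrite -(rot_cycle k) E /= rcons_path => /andP[].
  rewrite (@path_const _ _ _ (fun z => z \in s) _ _ _ Pt y) // => u v _ _ /eqP.
  exact: cycle_mem_eq.
(* Equal sizes turn the inclusion into equality, yet [c] lies in [s] and not in [t]. *)
have [_ eqts] := uniq_min_size Ut sub (eq_leq (etrans Ss (esym St))).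
by move: ct; rewrite eqts cs.
Qed.

Lemma no_mono_path_absurd : False.
Proof.
have [red [A [B [[UA SA CA] [UB SB CB dAB]]]]] := two_disjoint_cycles.
have closA x y : x \in A -> y \notin A -> col x y != red by apply: cycle_closed.
have closB x y : x \in B -> y \notin B -> col x y != red by apply: cycle_closed.
have dBA x : x \in B -> x \notin A by apply: contraL => /dAB.
have [a aA] : exists a, a \in A.
  by case: (A) SA => [|a ?] /= SA; [lia | exists a; rewrite inE eqxx].
have [b bB] : exists b, b \in B.
  by case: (B) SB => [|b ?] /= SB; [lia | exists b; rewrite inE eqxx].
(* [f] gives the new colours at [a]; the default [red] is reached only by the single vertex outside
   both cycles. *)
pose f x := if x \in A then col b x else if x \in B then col a x else red.
pose col' x y := if x == a then f y else if y == a then f x else col x y.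
have col'C x y : col' x y = col' y x.
  rewrite /col'; by case: (x =P a) => [->|_]; case: eqP => // ->.
have f_nred x : (x \in A) || (x \in B) -> f x != red.
  rewrite /f; case: ifP => [xA _|xA /= xB]; first exact: closB (dAB _ xA).
  by rewrite xB; apply: closA => //; apply: dBA.
(* Classes of lab contain the components of the red graph of col' off b. *)
pose lab z := if z == a then 2 else if z \in A then 0 else if z \in B then 1 else 2.
have col'_a y : col' a y = f y by rewrite /col' eqxx.
have col'_n x y : x != a -> y != a -> col' x y = col x y.
  by rewrite /col' => /negPf -> /negPf ->.
have [j [s [Us Ss bs Cs]]] := mono_cycle b col'C.
have red_lab u v : col' u v = red -> lab u = lab v.
  rewrite /lab /col'; case: (u =P a) => [_|_].
    move=> fv; case: (v == a) => //.
    move: (f_nred v); rewrite fv eqxx.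
    by case: (v \in A) => [/(_ isT)|] //; case: (v \in B) => [/(_ isT)|].
  case: (v =P a) => [_|_].
    move=> fu; move: (f_nred u); rewrite fu eqxx.
    by case: (u \in A) => [/(_ isT)|] //; case: (u \in B) => [/(_ isT)|].
  by move=> cuv; rewrite (cycle_mem_eq UA SA CA cuv) (cycle_mem_eq UB SB CB cuv).
have jred : j != red.
  apply/negP => /eqP jE; rewrite {}jE in Cs.
  case: s Us Ss bs Cs => [|x s] Us Ss bs Cs; first by move: Ss => /=; lia.
  have slab y : y \in x :: s -> lab y = lab x.
    apply: (@path_const _ _ (mono_rel col' red)).
      by move=> u v _ _ /eqP; apply: red_lab.
    by move: Cs; rewrite /= rcons_path => /andP[].
  have small r : {subset x :: s <= r} -> size r < 2 * n -> False.
    by move=> /(uniq_leq_size Us); rewrite Ss leqNgt => /negbTE ->.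
  (* Off [b] the classes have at most [2 * n - 1], [2 * n - 1] and 2 vertices, too few for the
     cycle. *)
  have [l0|[l1|l2]] : lab x = 0 \/ lab x = 1 \/ lab x = 2.
  - by rewrite /lab; case: (x == a); case: (x \in A); case: (x \in B); auto.
  - apply: (small (rem a A)); last by rewrite size_rem ?SA //; lia.
    move=> y /slab; rewrite l0 /lab (mem_rem_uniq _ UA) inE.
    by case: (y == a) => //=; case: (y \in A) => //; case: (y \in B).
  - apply: (small (rem b B)); last by rewrite size_rem ?SB //; lia.
    move=> y ys; have := slab y ys; rewrite l1 /lab (mem_rem_uniq _ UB) inE.
    case: (y =P b) ys => [->|_ _ /=]; first by rewrite (negPf bs).
    by case: (y == a) => //=; case: (y \in A) => //; case: (y \in B).
  - apply: (small (a :: enum (~: [set z in A ++ B]))).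
      move=> y /slab; rewrite l2 /lab in_cons mem_enum !inE mem_cat.
      by case: (y == a) => //=; case: (y \in A) => //; case: (y \in B).
    have UAB : uniq (A ++ B).
      by rewrite cat_uniq UA UB andbT; apply/hasPn => y; apply: dBA.
    suff c1 : size (enum (~: [set z in A ++ B])) = 1 by rewrite /= c1; lia.
    rewrite -cardE; apply/eqP; rewrite -(eqn_add2l #|[set z in A ++ B]|) cardsC cardV.
    by rewrite cardsE (card_uniqP UAB) size_cat SA SB; lia.
have path_real x p : a \notin x :: p ->
    path (mono_rel col' j) x p -> path (mono_rel col j) x p.
  rewrite inE negb_or => /andP[]; rewrite eq_sym.
  elim: p x => [|y p IH] x //= xa.
  rewrite inE negb_or eq_sym => /andP[ya ap] /andP[cxy py].
  by rewrite /mono_rel -(col'_n x y) // -/(mono_rel col' j x y) cxy IH.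
have no_real t : uniq t -> size t = 2 * n -> cycle (mono_rel col j) t -> False.
  move=> Ut St Ct; move: jred.
  by rewrite (cycle_same_color UA SA CA Ut St Ct) eqxx.
have [as_|as_] := boolP (a \in s); last first.
  apply: (no_real s) => //; case: (s) as_ Cs => [|x p] //= as_.
  by apply: path_real; move: as_; rewrite -rcons_cons mem_rcons !inE orbA orbb.
(* Read from [a], the cycle goes first to [x] and returns from the last vertex [y]; between them it
   avoids [a], so its colours there are the original ones. *)
have [k p E] := rot_to as_.
have {Us} : uniq (a :: p) by rewrite -E rot_uniq.
have {Ss} : size (a :: p) = 2 * n by rewrite -E size_rot.
have {Cs} : cycle (mono_rel col' j) (a :: p) by rewrite -E rot_cycle.
have {bs} : b \notin a :: p by rewrite -E mem_rot.
case: p {E} => [|x p] /= bp Cp Sp Up; first lia.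
case/andP: Up => ap Up; case/andP: Cp => /eqP; rewrite col'_a => fx.
rewrite rcons_path => /andP[/(path_real _ _ ap) Pp /eqP].
rewrite (col'C _ a) col'_a; set y := last x p => fy.
have fE z : f z = j -> (col b z = j) \/ (col a z = j).
  rewrite /f; case: ifP => _; first by left.
  by case: ifP => _ E; [right | rewrite E eqxx in jred].
(* The [2 * n - 1] vertices of the cycle other than [a], with [u] and [v] added at the ends, form a
   forbidden path. *)
have split_end u v : u \notin v :: x :: p -> v \notin x :: p ->
    col u x = j -> col v y = j -> False.
  move=> up vp ux vy; apply: no_path; exists j, (u :: x :: rcons p v); split.
  - rewrite -!rcons_cons rcons_uniq /= Up.
    by move: up vp; rewrite !inE !negb_or => /andP[uv ->] /andP[-> ->]; rewrite eq_sym uv.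
  - by rewrite /= size_rcons -Sp.
  - by rewrite /= rcons_path Pp /mono_rel ux (colC _ v) vy !eqxx.
have close u : u \notin x :: p -> col u x = j -> col u y = j -> False.
  move=> up ux uy; apply: (no_real (u :: x :: p)) => /=.
  - by rewrite up.
  - exact: Sp.
  - by rewrite rcons_path Pp /mono_rel ux (colC _ u) uy !eqxx.
have /andP[ba bp'] : (b != a) && (b \notin x :: p).
  by rewrite -negb_or -in_cons.
case: (fE _ fx) (fE _ fy) => [bx|ax] [by_|ay].
- exact: close bp' bx by_.
- by apply: (split_end b a) => //; rewrite in_cons negb_or ba.
- by apply: (split_end a b) => //; rewrite in_cons negb_or eq_sym ba.
- exact: close ap ax ay.
Qed.

End UpperBound.

(** * From subgraph copies to vertex sequences and back *)

Lemma contains_color_class_mono (N r : nat) (c : edge_coloring (complete_graph N) r)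
    (i : 'I_r) (G : sgraph) (f : G -> 'I_N) :
  injective f -> (forall x y, adj x y -> c [set f x; f y] = i) ->
  contains (color_class c i) G.
Proof.
move=> f_inj fc; exists f; split=> // x y xy.
rewrite /= /color_rel /= /complete_rel fc // eqxx andbT.
by apply: contraTneq xy => /f_inj ->; rewrite adj_irrefl.
Qed.

Lemma cycle_graph_contained (k N r : nat) (c : edge_coloring (complete_graph N) r)
    (i : 'I_r) : 1 < k -> contains (color_class c i) (cycle_graph k) ->
  exists s : seq 'I_N, [/\ uniq s, size s = k &
                          cycle (fun x y => c [set x; y] == i) s].
Proof.
move=> k1 [f [f_inj fadj]]; pose f' : 'I_k -> 'I_N := f.
exists (map f' (enum 'I_k)); split.
- by rewrite (map_inj_uniq f_inj) enum_uniq.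
- by rewrite size_map size_enum_ord.
apply: cycle_map_enum_ord => x.
(* Adjacency also requires [x] to differ from its cyclic successor, which holds because [1 < k]. *)
have /fadj /andP[] // : adj (s := cycle_graph k) x (ordS x).
rewrite /= /cycle_rel eqxx andbT -val_eqE /=.
have [lt|ge] := ltnP x.+1 k; first by rewrite modn_small // ltn_eqF.
have -> : x.+1 = k by apply/eqP; rewrite eqn_leq ge ltn_ord.
by rewrite modnn -lt0n -ltnS (leq_trans k1).
Qed.

(** The colouring is pulled back along an enumeration [g] of the vertices other than [b], and the
    cycle found is mapped forward. *)
Lemma mono_cycle_avoiding (n : nat) (V : finType) (col : V -> V -> 'I_3) (b : V) :
  0 < n -> #|V| = (4 * n).+1 -> ramsey3_arrows (4 * n) (cycle_graph (2 * n)) ->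
  (forall x y, col x y = col y x) ->
  exists i s, [/\ uniq s, size s = 2 * n, b \notin s & cycle (mono_rel col i) s].
Proof.
move=> n0 cardV arrows colC.
have cb : #|[set~ b]| = 4 * n by rewrite cardsC1 cardV.
pose g (x : 'I_(4 * n)) : V := enum_val (cast_ord (esym cb) x).
have g_inj : injective g by move=> x y /enum_val_inj /cast_ord_inj.
have gb x : g x != b by have := enum_valP (cast_ord (esym cb) x); rewrite !inE.
have [|c cE] := @edge_coloring_of_fun (complete_graph (4 * n)) 2
                  (fun x y => col (g x) (g y)); first by move=> x y; apply: colC.
have [i /cycle_graph_contained] := arrows c.
case; first lia.
move=> s [Us Ss Cs]; exists i, (map g s); split.
- by rewrite map_inj_uniq.
- by rewrite size_map.
- by apply/mapP => -[x _ E]; have := gb x; rewrite -E eqxx.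
- by rewrite cycle_map; apply: sub_cycle Cs => x y /=; rewrite cE.
Qed.

Lemma path_upper_bound (n : nat) : 1 < n ->
  ramsey3_arrows (4 * n) (cycle_graph (2 * n)) ->
  ramsey3_arrows (4 * n + 1) (path_graph (2 * n + 1)).
Proof.
move=> n1 arrows c.
have cardN : #|'I_(4 * n + 1)| = (4 * n).+1 by rewrite card_ord addn1.
pose col (x y : 'I_(4 * n + 1)) := c [set x; y].
have colC x y : col x y = col y x by rewrite /col setUC.
have cyc (col' : 'I_(4 * n + 1) -> 'I_(4 * n + 1) -> 'I_3) b :=
  mono_cycle_avoiding (col := col') b (ltnW n1) cardN arrows.
(* Tuples of fixed length form a finite type, so the existence of a monochromatic path is
   decidable. *)
case: (pickP (fun i : 'I_3 => [exists t : (2 * n + 1).-tuple 'I_(4 * n + 1),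
         uniq t && sorted (mono_rel col i) t])) => [i /existsP[t /andP[Ut Pt]]|none].
  exists i; apply: (@contains_color_class_mono _ _ _ _ (path_graph (2 * n + 1)) (tnth t)).
    exact/tuple_uniqP.
  have step (x y : 'I_(2 * n + 1)) : x.+1 = y -> c [set tnth t x; tnth t y] = i.
    move=> xy; pose z := tnth t x; rewrite !(tnth_nth z).
    move/(sortedP z): Pt => /(_ x); rewrite size_tuple xy ltn_ord => /(_ isT) /eqP.
    by [].
  by move=> x y /= /orP[/eqP|/eqP] /step // ; rewrite setUC.
case: (no_mono_path_absurd n1 cardN cyc colC) => -[i [t [Ut St Pt]]].
have /eqP St' : size t = 2 * n + 1 by rewrite St addn1.
have := none i => /existsP[]; exists (Tuple St').
by rewrite /= Ut Pt.
Qed.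

(** * Lower bound: a colouring with small components *)

Lemma path_lower_bound (n M : nat) : 0 < n ->
  ramsey3_arrows M (path_graph (2 * n + 1)) -> 4 * n + 1 <= M.
Proof.
move=> n0 arrows; rewrite addn1 ltnNge; apply/negP => M4.
(* The part of [x] is numbered [x %/ n], below 4; [hi] and [od] are its binary digits. Edges inside
   a part get colour 0. *)
pose hi (x : 'I_M) := 2 <= x %/ n; pose od (x : 'I_M) := odd (x %/ n).
pose col (x y : 'I_M) : 'I_3 :=
  if hi x == hi y then inord 0 else if od x == od y then inord 1 else inord 2.
have colC x y : col x y = col y x.
  by rewrite /col (eq_sym (hi x)) (eq_sym (od x)).
have [c cE] := @edge_coloring_of_fun (complete_graph M) 2 col colC.
have [i [f [f_inj fadj]]] := arrows c.
(* [side] is the linear form on F_2^2 preserved by edges of colour [i]; [other] completes it to a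
   coordinate system. *)
pose side (x : 'I_M) : bool :=
  if i == 0 :> nat then hi x else if i == 1 :> nat then od x else hi x (+) od x.
pose other (x : 'I_M) : bool := if i == 0 :> nat then od x else hi x.
have side_eq x y : col x y = i -> side x = side y.
  move/(congr1 val); rewrite /col /side.
  by case: (hi x); case: (hi y); case: (od x); case: (od y);
     rewrite /= inordK // => <-.
(* [x0] is vertex 0 of the path; [side] propagates from it edge by edge. *)
have f_side (x : 'I_(2 * n + 1)) (x0 := Ordinal (leq_addl (2 * n) 1)) :
    side (f x) = side (f x0).
  case: x => m; elim: m => [|m IH] mlt; first by congr (side (f _)); apply: val_inj.
  rewrite -(IH (ltnW mlt)); apply: side_eq; rewrite -cE.
  have /fadj /andP[_ /eqP] // :
    adj (s := path_graph (2 * n + 1)) (Ordinal mlt) (Ordinal (ltnW mlt)).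
  by rewrite /= /path_rel /= eqxx orbT.
(* Once [side] is fixed, [other] and the residue modulo [n] determine the vertex, so [2 * n + 1]
   vertices would inject into [2 * n] pairs. *)
pose h (x : 'I_(2 * n + 1)) : 'I_n * bool := (Ordinal (ltn_pmod (f x) n0), other (f x)).
have h_inj : injective h.
  move=> x y [Emod Eoth]; apply/f_inj/val_inj => /=.
  rewrite (divn_eq (f x) n) (divn_eq (f y) n) Emod; congr (_ * _ + _).
  have lt4 (z : 'I_M) : z %/ n < 4.
    by rewrite ltn_divLR //; apply: leq_trans (ltn_ord z) M4.
  have Eside : side (f x) = side (f y) by rewrite !f_side.
  have [Ehi Eod] : hi (f x) = hi (f y) /\ od (f x) = od (f y).
    move: Eside Eoth; rewrite /side /other.
    by case: ifP => _; last case: ifP => _; case: (hi (f x)); case: (hi (f y));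
       case: (od (f x)); case: (od (f y)).
  by move: Ehi Eod (lt4 (f x)) (lt4 (f y)); rewrite /hi /od;
     case: (f x %/ n) => [|[|[|[|]]]] //; case: (f y %/ n) => [|[|[|[|]]]].
have := leq_card h h_inj; rewrite card_ord card_prod card_ord card_bool; lia.
Qed.

Theorem theorem6 (n : nat) (hn : 3 <= n)
    (hC : is_ramsey3 (cycle_graph (2 * n)) (4 * n)) :
  is_ramsey3 (path_graph (2 * n + 1)) (4 * n + 1).
Proof.
split=> [|M]; first by apply: path_upper_bound (ltnW hn) hC.1.
by apply: path_lower_bound; lia.
Qed.
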